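(* Let $(X,d,\mu)$ be a metric measure space (with negligible cut loci), with geodesic dimension $\mathcal{N}(x)$ at $x\in X$, that satisfies the measure contraction property $\mathrm{MCP}(K,N)$ for some $K\in\mathbb{R}$ and $N>1$, or $K\le0$ and $N=1$. Then $$N\ \ge\ \sup\{\mathcal{N}(x)\mid x\in X\}.$$
   Context: **Metric measure spaces.** A metric measure space $(X,d,\mu)$ is a length space $(X,d)$ (i.e. $d(x,y)=\inf_\gamma\ell(\gamma)$ over rectifiable curves from $x$ to $y$) with a Borel measure $\mu$ such that $0<\mu(\mathcal{B}(x,r))<+\infty$ for all metric balls $\mathcal{B}(x,r)$ with $x\in X$, $r>0$, having negligible cut loci: for any $x\in X$ there exist a $\mu$-negligible set $\mathcal{C}(x)$ and a measurable map $\Phi^x:(X\setminus\mathcal{C}(x))\times[0,1]\to X$ (fixed from now on) such that $t\mapsto\Phi^x(y,t)$ is the unique (constant speed) minimizing geodesic from $x$ to $y$. **Homothety.** For $\Omega\subseteq X$, $x\in X$, $t\in[0,1]$, the geodesic homothety of center $x$ and ratio $t$ is $\Omega_t:=\{\Phi^x(y,t)\mid y\in\Omega\setminus\mathcal{C}(x)\}$. **Geodesic dimension.** For $x\in X$ and $s>0$, $$C_s(x):=\sup\left\{\limsup_{t\to0^+}\frac{1}{t^s}\frac{\mu(\Omega_t)}{\mu(\Omega)}\ \Big|\ \Omega\text{ measurable, bounded, }0<\mu(\Omega)<+\infty\right\},$$ where $\Omega_t$ is the homothety with center $x$. The geodesic dimension at $x$ is $$\mathcal{N}(x):=\inf\{s>0\mid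 C_s(x)=+\infty\}=\sup\{s>0\mid C_s(x)=0\},$$ with the conventions $\inf\emptyset=+\infty$ and $\sup\emptyset=0$. **MCP.** Let $s_K(t)=\frac{1}{\sqrt K}\sin(\sqrt K t)$ if $K>0$; $s_K(t)=t$ if $K=0$; $s_K(t)=\frac{1}{\sqrt{-K}}\sinh(\sqrt{-K}t)$ if $K<0$. Let $K\in\mathbb{R}$ and $N>1$, or $K\le0$ and $N=1$. $(X,d,\mu)$ satisfies $\mathrm{MCP}(K,N)$ if for any $x\in X$ and any measurable set $\Omega$ with $0<\mu(\Omega)<+\infty$ (and with $\Omega\subset\mathcal{B}(x,\pi\sqrt{(N-1)/K})$ if $K>0$), with $\Omega_t$ the homothety with center $x$, $$\mu(\Omega_t)\ge\int_\Omega t\left[\frac{s_K(t\,d(x,z)/\sqrt{N-1})}{s_K(d(x,z)/\sqrt{N-1})}\right]^{N-1}d\mu(z),\qquad\forall t\in[0,1],$$ where $0/0=1$ and the term in square brackets is $1$ if $K\le0$ and $N=1$. *)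

(* Defs.v *)
From HB Require Import structures.
From mathcomp Require Import all_boot all_order all_algebra.
From mathcomp Require Import all_classical all_reals all_analysis.

From mathcomp Require Import lra.

Set Implicit Arguments.
Unset Strict Implicit.
Unset Printing Implicit Defensive.

Import Order.TTheory GRing.Theory Num.Theory.
Import numFieldNormedType.Exports.

Local Open Scope classical_set_scope.
Local Open Scope ring_scope.

(* Measurable types are pointed in the library, so the Borel sigma-algebra of a
   metric space can only be formed on a nonempty one. *)
#[short(type="pmetricType")]
HB.structure Definition PointedMetric (R : numDomainType) :=
  {X of Metric R X & Pointed X}.

Notation borel X := (g_sigma_algebraType (@open X)).

Section LengthSpace.
Context (R : realType) (X : pmetricType R).
Implicit Types (x y : X) (g : R -> X).

(* Metric analogue of `variation`: s lists the points of a subdivision of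
   [a, b] after a, see `itv_partition`. *)
Definition metric_variation (a : R) g (s : seq R) : R :=
  let G := g \o nth a (a :: s) in
  \sum_(0 <= n < size s) mdist (G n) (G n.+1).

Definition curve_length g : \bar R :=
  ereal_sup [set (metric_variation 0 g s)%:E | s in itv_partition 0 1].

Definition rectifiable_curve x y g : Prop :=
  [/\ {within `[0, 1], continuous g}, g 0 = x, g 1 = y &
      (curve_length g < +oo)%E].

Definition length_space : Prop :=
  forall x y, (mdist x y)%:E =
    ereal_inf [set curve_length g | g in rectifiable_curve x y].

(* Constant-speed minimizing geodesic from x to y; only the restriction of g to
   [0, 1] matters. *)
Definition geodesic x y g : Prop :=
  [/\ g 0 = x, g 1 = y &
      {in `[0, 1] &, forall s t, mdist (g s) (g t) = `|s - t| * mdist x y}].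

Definition metric_bounded (A : set X) : Prop :=
  exists (c : X) (r : R), A `<=` ball c r.

End LengthSpace.

(* Measurability on D for the trace sigma-algebra.  `measurable_fun` is not
   suitable, being vacuously true when D itself is not measurable. *)
Definition trace_measurable_fun d d' (T : measurableType d)
    (U : measurableType d') (D : set T) (f : T -> U) : Prop :=
  forall Y, measurable Y -> strace measurable D (D `&` f @^-1` Y).

Section MetricMeasureSpace.
Context (R : realType) (X : pmetricType R).
Variable mu : {measure set (borel X) -> \bar R}.
(* C x is the cut locus of x, and Phi x (y, t) the point of parameter t on the
   geodesic from x to y.  Phi x is meaningful on (~` C x) `*` `[0, 1] only. *)
Variables (C : X -> set X) (Phi : X -> X * R -> X).

(* The product sigma-algebra used for Phi x is the Borel one: since balls have
   positive finite measure, X is separable. *)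
Definition negligible_cut_loci : Prop :=
  forall x, [/\ mu.-negligible (C x : set (borel X)),
    trace_measurable_fun ((~` C x) `*` `[0, 1] : set (borel X * R))
      (Phi x : borel X * R -> borel X)
    & forall y, ~ C x y ->
        geodesic x y (fun t => Phi x (y, t)) /\
        forall g, geodesic x y g -> {in `[0, 1], forall t, g t = Phi x (y, t)}].

Definition metric_measure_space : Prop :=
  [/\ length_space X,
      forall (x : X) (r : R), 0 < r ->
        (0 < mu (ball x r : set (borel X)) < +oo)%E
    & negligible_cut_loci].

Definition homothety (x : X) (t : R) (A : set X) : set X :=
  [set Phi x (y, t) | y in A `\` C x].

(* The homothety of a measurable set is an image, which need not be Borel; its
   measure is the outer measure induced by mu, which extends mu (and its
   completion). *)
Local Notation "mu ^*" := (mu_ext mu) : ereal_scope.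

Definition geodesic_coef (s : R) (x : X) : \bar R :=
  ereal_sup [set limf_esup
      (fun t : R => (((t `^ s)^-1)%:E * (mu^* (homothety x t A) / mu A))%E) 0^'+
    | A in [set A : set (borel X) |
        [/\ measurable A, metric_bounded (A : set X) & (0 < mu A < +oo)%E]]].

Definition geodesic_dim (x : X) : \bar R :=
  ereal_inf [set s%:E | s in [set s : R | 0 < s /\ geodesic_coef s x = +oo%E]].

Definition sK (K t : R) : R :=
  if 0 < K then sin (Num.sqrt K * t) / Num.sqrt K
  else if K == 0 then t
  else let k := Num.sqrt (- K) in ((expR (k * t) - expR (- (k * t))) / 2) / k.

(* The quotient in square brackets, as a function of r = d(x, z). *)
Definition mcp_bracket (K N t r : R) : R :=
  let num := sK K (t * r / Num.sqrt (N - 1)) in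
  let den := sK K (r / Num.sqrt (N - 1)) in
  if (K <= 0) && (N == 1) then 1
  else if (num == 0) && (den == 0) then 1
  else num / den.

Definition MCP (K N : R) : Prop :=
  forall (x : X) (A : set (borel X)), measurable A -> (0 < mu A < +oo)%E ->
    (0 < K -> A `<=` ball x (pi * Num.sqrt ((N - 1) / K))) ->
    {in `[0, 1], forall t : R,
      (\int[mu]_(z in A) (t * mcp_bracket K N t (mdist x (z : X)) `^ (N - 1))%:E
       <= mu^* (homothety x t A))%E}.

Lemma metric_ball_open (x : X) (r : R) : open (ball x r).
Proof.
rewrite openE => y xy; rewrite /interior -nbhs_ballE.
move: xy; rewrite ballEmdist/= => xy.
exists (r - mdist x y); first by rewrite /= subr_gt0.
move=> z; rewrite !ballEmdist/= ltrBrDl; apply: le_lt_trans.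
exact: metric_triangle.
Qed.

Lemma geodesic_coef_ge0 s x : metric_measure_space -> (0 <= geodesic_coef s x)%E.
Proof.
move=> [_ mub _].
have [bg0 bgoo] := andP (mub x 1 ltr01).
apply: (@le_trans _ _ (limf_esup
   (fun t : R => (((t `^ s)^-1)%:E * (mu^* (homothety x t (ball x 1)) /
     mu (ball x 1 : set (borel X))))%E) 0^'+)).
  apply: limf_esup_ge0; first exact: filter_not_empty.
  move=> t; rewrite mule_ge0 ?lee_fin ?invr_ge0 ?powR_ge0//.
  by rewrite mule_ge0 ?mu_ext_ge0// inve_ge0.
apply: ereal_sup_ubound; exists (ball x 1) => //; split; last exact/andP.
- by apply: sub_sigma_algebra; exact: metric_ball_open.
- by exists x, 1.
Qed.

Lemma geodesic_coef_jump s s' x : metric_measure_space -> s < s' ->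
  geodesic_coef s x != 0%E -> geodesic_coef s' x = +oo%E.
Proof.
move=> hX ss' c0.
have : (0 < geodesic_coef s x)%E by rewrite lt0e c0 geodesic_coef_ge0.
move=> /ereal_sup_gt[_ [A A0 <-]].
set f : R -> \bar R := (F in limf_esup F _) => L0.
apply/eqP; rewrite -leye_eq.
pose f' := fun t : R =>
  (((t `^ s')^-1)%:E * (mu^* (homothety x t A) / mu A))%E.
apply: (@le_trans _ _ (limf_esup f' 0^'+)); last first.
  by apply: ereal_sup_ubound; exists A.
apply: le_ereal_inf_tmp => _ [V V0 <-].
have [e e0 eL] : exists2 e : R, 0 < e & (e%:E < limf_esup f 0^'+)%E.
  case: (limf_esup f 0^'+) L0 => [r| |]//; last by move=> _; exists 1; rewrite ?ltry.
  rewrite lte_fin => r0; exists (r / 2); first by rewrite divr_gt0.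
  by rewrite lte_fin ltr_pdivrMr// ltr_pMr// ltr1n.
rewrite leye_eq; apply/eqP/eqyP => M M0.
pose d := (e / M) `^ (s' - s)^-1.
have d0 : 0 < d by rewrite powR_gt0// divr_gt0.
pose W : set R := V `&` `]0, d[.
have VW : 0^'+ W.
  apply: filterI => //.
  apply: filterS (filterI (nbhs_right_gt 0) (nbhs_right_lt d0)) => t [t0 td].
  by rewrite /= in_itv/= t0.
have : (e%:E < ereal_sup (f @` W))%E.
  by apply: lt_le_trans eL _; apply: ereal_inf_lbound; exists W.
move=> /ereal_sup_gt[_ [t [Vt tI] <-] eft].
move: tI; rewrite /= in_itv/= => /andP[t0 td].
apply: (@le_trans _ _ (f' t)); last by apply: ereal_sup_ubound; exists t.
have -> : f' t = (((t `^ (s' - s))^-1)%:E * f t)%E.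
  rewrite /f' /f [RHS]muleA -EFinM -invfM -powRD ?subrK//.
  by apply/implyP; rewrite (gt_eqF t0).
have tsd : t `^ (s' - s) < e / M.
  have -> : e / M = d `^ (s' - s).
    by rewrite -powRrM mulVf ?powRr1 ?divr_ge0 ?ltW// gt_eqF// subr_gt0.
  by apply: gt0_ltr_powR; rewrite ?subr_gt0// nnegrE ltW.
have ts0 : 0 < t `^ (s' - s) by rewrite powR_gt0.
apply: (@le_trans _ _ (((t `^ (s' - s))^-1)%:E * e%:E)%E); last first.
  by apply: lee_wpmul2l; [rewrite lee_fin invr_ge0 ltW|exact: ltW].
rewrite -EFinM lee_fin mulrC ler_pdivlMr// mulrC -ler_pdivlMr//; exact: ltW.
Qed.

(* 0 is adjoined because the supremum of the empty set is 0 by convention. *)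
Lemma geodesic_dim_supE x : metric_measure_space ->
  geodesic_dim x = ereal_sup (0%E |`
    [set s%:E | s in [set s : R | 0 < s /\ geodesic_coef s x = 0%E]]).
Proof.
move=> hX; apply/eqP; rewrite eq_le; apply/andP; split.
  rewrite leNgt; apply/negP => lt_dim.
  set S := ereal_sup _ in lt_dim.
  have sup0 : (0 <= S)%E by apply: ereal_sup_ubound; left.
  have [s [s' [Ss ss' s'I]]] : exists s s' : R,
      [/\ (S < s%:E)%E, s < s' & (s'%:E < geodesic_dim x)%E].
    move: lt_dim sup0; clearbody S.
    case: S => [a| |] //; case: (geodesic_dim x) => [b| |] // + a0.
    - rewrite lte_fin => ab; exists (a + (b - a) / 3), (a + (b - a) / 2).
      by rewrite !lte_fin; split; lra.
    - by move=> _; exists (a + 1), (a + 2); rewrite !lte_fin ltry; split => //; lra.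
  have s0 : 0 < s by rewrite -lte_fin (le_lt_trans sup0).
  have [c0|cN0] := eqVneq (geodesic_coef s x) 0%E.
    move: Ss; rewrite ltNge => /negP; apply.
    by apply: ereal_sup_ubound; right; exists s.
  move: s'I; rewrite ltNge => /negP; apply.
  apply: ereal_inf_lbound; exists s' => //; split; first exact: lt_trans ss'.
  exact: geodesic_coef_jump hX ss' cN0.
apply: le_ereal_inf_tmp => _ [s' [s'0 cs'] <-].
apply: ge_ereal_sup => _ [->|[s [s0 cs] <-]]; first by rewrite lee_fin ltW.
rewrite lee_fin leNgt; apply/negP => ss'.
have /(geodesic_coef_jump hX ss') : geodesic_coef s' x != 0%E by rewrite cs'.
by rewrite cs.
Qed.
End MetricMeasureSpace.

(* Main.v *)
(* On a small ball centred at x the MCP bracket is at least c t for some c > 0,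
   because s_K(v) is comparable to v near 0.  MCP(K, N) then bounds the measure
   of the homothety of ratio t of that ball below by a constant times t ^ N, so
   that C_N(x) > 0, hence C_s(x) = +oo for all s > N. *)
Require Import Defs.
From mathcomp Require Import all_boot all_order all_algebra.
From mathcomp Require Import all_classical all_reals all_analysis.
From mathcomp Require Import lra.

Import Order.TTheory GRing.Theory Num.Theory.
Import numFieldNormedType.Exports.

Local Open Scope classical_set_scope.
Local Open Scope ring_scope.

(** By the mean value theorem [sin y = cos c * y] with [0 <= c <= y], and [cos] decreases on
    [[0, pi]], which contains [[0, 1]]. *)
Lemma sin_bounds (R : realType) (y : R) : 0 <= y <= 1 ->
  cos 1 * y <= sin y <= y.
Proof.
move=> /andP[y0 y1].
have [|c cI] := @MVT_segment R sin cos 0 y y0 (fun x _ => is_derive_sin x).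
  by apply: continuous_subspaceT => z; exact: continuous_sin.
rewrite sin0 !subr0 => ->.
move: cI; rewrite in_itv/= => /andP[c0 cy].
have pi2 : 1 <= pi / 2 :> R by exact: pihalf_ge1.
rewrite ler_wpM2r//=; first by rewrite ler_piMl// cos_le1.
by rewrite leNgt ltr_cos ?in_itv/= ?ltNge ?(le_trans cy)//; lra.
Qed.

Lemma sinh_bounds (R : realType) (y : R) : 0 <= y <= 1 / 2 ->
  y / 2 <= (expR y - expR (- y)) / 2 <= 3 * y / 2.
Proof.
move=> /andP[y0 y1].
have e1 := expR_ge1Dx y; have e2 := expR_ge1Dx (- y).
have ee : expR y * expR (- y) = 1 by rewrite expRN divff// gt_eqF// expR_gt0.
have ep := expR_gt0 (- y).
(* Since [expR (- y)] is the inverse of [expR y], one has [expR (- y) <= 1] and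
   [expR y <= 1 / (1 - y) <= 1 + 2 * y]; the last inequality is where [y <= 1 / 2] enters. *)
apply/andP; split; nra.
Qed.

(** Both sides are wanted because [sK] occurs in the numerator and in the denominator of the
    bracket. For nonzero [K], [e] keeps [k * v] in the range of the bounds above, and the division
    by [k] cancels the factor [k] there. *)
Lemma sK_bounds (R : realType) (K : R) : exists a b e : R,
  [/\ 0 < a, a <= b, 0 < e &
      forall v, 0 <= v <= e -> a * v <= sK K v <= b * v].
Proof.
rewrite /sK; case: ltgtP => [K0|K0|_]; last first.
- by exists 1, 1, 1; split => // v _; rewrite mul1r lexx.
- set k := Num.sqrt (- K).
  have k0 : 0 < k by rewrite sqrtr_gt0 oppr_gt0.
  exists (1 / 2), (3 / 2), (1 / 2 / k); split.
  + by rewrite divr_gt0.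
  + lra.
  + by rewrite !divr_gt0.
  + move=> v /andP[v0]; rewrite ler_pdivlMr// mulrC => vk.
    have /sinh_bounds : 0 <= k * v <= 1 / 2 by rewrite vk mulr_ge0// ltW.
    by rewrite (ler_pdivlMr _ _ k0) (ler_pdivrMr _ _ k0); lra.
- set k := Num.sqrt K.
  have k0 : 0 < k by rewrite sqrtr_gt0.
  exists (cos 1), 1, (1 / k); split.
  + exact: cos1_gt0.
  + exact: cos_le1.
  + by rewrite divr_gt0.
  + move=> v /andP[v0]; rewrite ler_pdivlMr// mulrC => vk.
    have /sin_bounds : 0 <= k * v <= 1 by rewrite vk mulr_ge0// ltW.
    by rewrite (ler_pdivlMr _ _ k0) (ler_pdivrMr _ _ k0) mul1r -mulrA [v * k]mulrC.
Qed.

(** For [1 < N] put [u = d / sqrt (N - 1)]: the numerator is at least [a * (t * u)] and the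
    denominator at most [b * u], so [u] cancels and leaves [c = a / b]. The radius is chosen so that
    [u <= e]. *)
Lemma mcp_bracket_lower_bound (R : realType) (K N : R) :
  1 < N \/ (K <= 0 /\ N = 1) -> exists c r : R, [/\ 0 < c, 0 < r &
    forall t d, 0 <= t <= 1 -> 0 <= d <= r -> c * t <= mcp_bracket K N t d].
Proof.
move=> [N1|[K0 ->]]; last first.
  exists 1, 1; split => // t d /andP[_ t1] _.
  by rewrite /mcp_bracket K0 eqxx mul1r.
have [a [b [e [a0 ab e0 sKab]]]] := sK_bounds R K.
have b0 : 0 < b by exact: lt_le_trans ab.
set q := Num.sqrt (N - 1).
have q0 : 0 < q by rewrite sqrtr_gt0 subr_gt0.
exists (a / b), (e * q); split; rewrite ?divr_gt0 ?mulr_gt0//.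
move=> t d /andP[t0 t1] /andP[d0]; rewrite -ler_pdivrMr// => dq.
rewrite /mcp_bracket (gt_eqF N1) andbF -/q -[t * d / q]mulrA.
have u0 : 0 <= d / q by rewrite divr_ge0// ltW.
set u := d / q in dq u0 *.
have /andP[den1 den2] : a * u <= sK K u <= b * u by rewrite sKab// u0.
have /andP[num1 _] : a * (t * u) <= sK K (t * u) <= b * (t * u).
  by rewrite sKab// mulr_ge0//= (le_trans _ dq)// ler_piMl.
(* At the centre, [u = 0], the bracket is [1] by the convention for [0 / 0], and [a <= b]
   suffices. *)
have [u_eq0|uN0] := eqVneq u 0.
  move: den1 den2; rewrite u_eq0 !mulr0 => den1 den2.
  have s0 : sK K 0 = 0 by apply/eqP; rewrite eq_le den2.
  rewrite s0 eqxx /= (le_trans _ t1)// ler_piMl//.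
  by rewrite ler_pdivrMr// mul1r.
have up : 0 < u by rewrite lt0r uN0.
have denp : 0 < sK K u by apply: lt_le_trans den1; rewrite mulr_gt0.
rewrite (gt_eqF denp) andbF ler_pdivlMr//.
apply: le_trans num1; rewrite -!mulrA; apply: ler_wpM2l; first exact: ltW.
by rewrite mulrCA ler_wpM2l// ler_pdivrMl.
Qed.

(** A simple function below [k] on [A] is also below [f], so the suprema defining the two integrals
    compare directly. This applies to the MCP integrand without a measurability proof. *)
Lemma mul_measure_le_integral d (T : measurableType d) (R : realType)
    (mu : {measure set T -> \bar R}) (A : set T) (f : T -> \bar R) (k : R) :
  measurable A -> 0 <= k -> (forall z, A z -> (k%:E <= f z)%E) ->
  (k%:E * mu A <= \int[mu]_(z in A) f z)%E.
Proof.
move=> mA k0 kf; rewrite -integral_cst// ge0_integralE//.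
rewrite [leRHS]ge0_integralE; last first.
  by move=> z /kf; apply: le_trans; rewrite lee_fin.
apply: ereal_sup_le => _ [h hk <-]; exists h => // z; apply: le_trans (hk z) _.
rewrite /patch; case: ifPn => // /[!inE]; exact: kf.
Qed.

Lemma geodesic_coef_neq0 (R : realType) (X : pmetricType R)
    (mu : {measure set (borel X) -> \bar R})
    (C : X -> set X) (Phi : X -> X * R -> X) (K N : R) (x : X) :
  metric_measure_space mu C Phi -> 1 < N \/ (K <= 0 /\ N = 1) ->
  MCP mu C Phi K N -> geodesic_coef mu C Phi N x != 0%E.
Proof.
move=> hX hKN hMCP; have [c [r [c0 r0 cP]]] := mcp_bracket_lower_bound R K N hKN.
have N1 : 1 <= N by case: hKN => [/ltW|[_ ->]].
(* The cap is the restriction on [A] in [MCP] for [0 < K]; it is positive because [0 < K] forces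
   [1 < N]. *)
pose q := if 0 < K then Num.min r (pi * Num.sqrt ((N - 1) / K)) else r.
have q0 : 0 < q.
  rewrite /q; case: ifPn => // K0; rewrite lt_min r0 mulr_gt0 ?pi_gt0//.
  rewrite sqrtr_gt0 divr_gt0// subr_gt0; case: hKN => // -[K0'].
  by rewrite leNgt K0 in K0'.
have qr : q <= r by rewrite /q; case: ifP; rewrite ?ge_min lexx.
pose A : set (borel X) := ball x q.
have mA : measurable A by apply: sub_sigma_algebra; exact: metric_ball_open.
have muA : (0 < mu A < +oo)%E by case: hX => _ + _; apply.
pose k := c `^ (N - 1).
have k0 : 0 < k by rewrite powR_gt0.
have muAt t : 0 < t < 1 ->
    ((k * t `^ N)%:E * mu A <= mu_ext mu (homothety C Phi x t A))%E.
  move=> /andP[t0 t1]; apply: (@le_trans _ _ (\int[mu]_(z in A)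
      (t * mcp_bracket K N t (mdist x (z : X)) `^ (N - 1))%:E)%E); last first.
    apply: hMCP => //; last by rewrite in_itv/= !ltW.
    by move=> K0; apply: le_ball; rewrite /q K0 ge_min lexx orbT.
  apply: mul_measure_le_integral => //; first by rewrite mulr_ge0 ?powR_ge0.
  move=> z; rewrite /A ballEmdist/= => xz; rewrite lee_fin.
  (* The exponent [N] is the factor [t] of the integrand times the power [N - 1] of the bracket. *)
  have -> : k * t `^ N = t * (c * t) `^ (N - 1).
    by rewrite powRM ?ltW// mulrCA mulr_powRB1 ?ltW// (lt_le_trans ltr01).
  have ct := cP t (mdist x z).
  rewrite ler_pM2l// ge0_ler_powR ?nnegrE ?subr_ge0//.
  - by rewrite mulr_ge0 ?ltW.
  - apply: le_trans (ct _ _); rewrite ?mulr_ge0 ?mdist_ge0 ?ltW//.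
    exact: lt_le_trans qr.
  - apply: ct; rewrite ?mdist_ge0 ?ltW//; exact: lt_le_trans qr.
rewrite gt_eqF//; apply: (@lt_le_trans _ _ k%:E); first by rewrite lte_fin.
apply: le_trans (ereal_sup_ubound _); last first.
  by exists A => //; split => //; exists x, q.
(* The upper limit is an infimum over neighbourhoods [V] of suprema over [V]; one [t] of [V] in []0,
   1[] bounds the supremum below by [k]. *)
apply: le_ereal_inf_tmp => _ [V V0 <-].
have : 0^'+ (V `&` `]0, 1[).
  apply: filterI => //.
  apply: filterS (filterI (nbhs_right_gt 0) (nbhs_right_lt ltr01)) => t [t0 t1].
  by rewrite /= in_itv/= t0.
move=> /filter_ex[t [Vt]]; rewrite /= in_itv/= => t01.
apply: le_trans (ereal_sup_ubound _); last by exists t.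
have := muAt t t01.
have tN : 0 < t `^ N by case/andP: t01 => *; exact: powR_gt0.
have [m muAm] : exists m, mu A = m%:E.
  by exists (fine (mu A)); rewrite fineK// ge0_fin_numE; case/andP: muA => // /ltW.
move: muA; rewrite muAm !lte_fin => /andP[m0 _].
rewrite inver gt_eqF//.
(* The outer measure of the homothety may be infinite; the quotient is then [+oo]. *)
case: (mu_ext _ _) => [h| |] //.
  rewrite -!EFinM !lee_fin => kh.
  by rewrite mulrC ler_pdivlMr// ler_pdivlMr.
by move=> _; rewrite gt0_mulye ?gt0_muley ?lte_fin ?invr_gt0// leey.
Qed.

Theorem theorem6 (R : realType) (X : pmetricType R)
    (mu : {measure set (borel X) -> \bar R})
    (C : X -> set X) (Phi : X -> X * R -> X) (K N : R)
    (hX : metric_measure_space mu C Phi)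
    (hKN : 1 < N \/ (K <= 0 /\ N = 1))
    (hMCP : MCP mu C Phi K N) :
  (ereal_sup [set geodesic_dim mu C Phi x | x in [set: X]] <= N%:E)%E.
Proof.
have N0 : 0 < N by case: hKN => [/(lt_trans ltr01)|[_ ->]].
(* The coefficient at [N] is only known to be nonzero; it jumps to [+oo] at every larger exponent,
   hence the slack [e]. *)
apply: ge_ereal_sup => _ [x _ <-]; apply/lee_addgt0Pr => e e0.
apply: ereal_inf_lbound; exists (N + e) => //; split; first exact: addr_gt0.
apply: (geodesic_coef_jump hX (s := N)); first by rewrite ltrDl.
exact: (geodesic_coef_neq0 _ _ _ _ _ _ _ _ hX hKN hMCP).
Qed.
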